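(* Let $\mathbb K$ be a commutative semiring and let $M,N\ge1$ be integers. The $\mathbb K$-ModPro $\mathbb K(M)\otimes\mathbb K(N)$ is isomorphic (as a $\mathbb K$-ModPro) to $\mathbb K(MN)$.
   Context: Notation: $[N]=\{1,\dots,N\}$; ''module over a semiring'' means semimodule. PRO: a bigraded set $\mathcal P=\bigcup_{m,n\in\mathbb N}\mathcal P_{m,n}$ with operations $\leftrightarrow:\mathcal P_{m,n}\times\mathcal P_{m',n'}\to\mathcal P_{m+m',n+n'}$ and $\updownarrow:\mathcal P_{m,n}\times\mathcal P_{n,p}\to\mathcal P_{m,p}$ such that: both are associative; the interchange law $(p\updownarrow q)\leftrightarrow(p'\updownarrow q')=(p\leftrightarrow p')\updownarrow(q\leftrightarrow q')$ holds whenever both vertical compositions on the left are defined; for each $n$ there is a unique $Id_n\in\mathcal P_{n,n}$ with $Id_m\updownarrow p=p\updownarrow Id_n=p$ for all $p\in\mathcal P_{m,n}$, and $Id_n=Id_1\leftrightarrow\cdots\leftrightarrow Id_1$ ($n$ factors) for $n\ge1$; there is $\varepsilon$ with $\varepsilon\leftrightarrow p=p\leftrightarrow\varepsilon=p$ for all $p$. A morphism of PROs is a graded map preserving $\leftrightarrow$, $\updownarrow$ and all $Id_n$. $\mathbb K$-ModPro: a PRO in which each component $\mathtt M_{m,n}$ is a $\mathbb K$-module and both $\leftrightarrow$ and $\updownarrow$ are distributive over $+$ on both sides and compatible with scalars ($a\cdot(p\leftrightarrow q)=(a\cdot p)\leftrightarrow q=p\leftrightarrow(a\cdot q)$, and likewise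 for $\updownarrow$). An isomorphism of $\mathbb K$-ModPros is an isomorphism of PROs that is $\mathbb K$-linear on each graded component. Hypermatrices: $\mathbb K(N)=\bigcup_{p,q\ge0}\mathbb K(N;p,q)$, where $\mathbb K(N;p,q)$ is the $\mathbb K$-module of families $A=(A^I_J)_{I\in[N]^p,J\in[N]^q}$ with entries in $\mathbb K$ ($\mathbb K(N;0,0)=\mathbb K$), with $(A\leftrightarrow B)^{II'}_{JJ'}=A^I_J\,B^{I'}_{J'}$ ($II'$ denotes concatenation) and $(A\updownarrow B)^I_J=\sum_{K\in[N]^q}A^I_K B^K_J$ for $A\in\mathbb K(N;p,q)$, $B\in\mathbb K(N;q,r)$ . This is a $\mathbb K$-ModPro. $\mathbb K(M)\otimes\mathbb K(N):=\bigcup_{p,q\ge0}\mathbb K(M;p,q)\otimes_{\mathbb K}\mathbb K(N;p,q)$, with operations determined (bilinearly) by $(A\otimes A')\leftrightarrow(B\otimes B')=(A\leftrightarrow B)\otimes(A'\leftrightarrow B')$ and $(A\otimes A')\updownarrow(B\otimes B')=(A\updownarrow B)\otimes(A'\updownarrow B')$; this is a $\mathbb K$-ModPro. *)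

(* Defs.v *)
From HB Require Import structures.
From mathcomp Require Import all_boot all_order all_algebra.
From mathcomp Require Import boolp.

Set Implicit Arguments.
Unset Strict Implicit.
Unset Printing Implicit Defensive.

Import GRing.Theory.
Local Open Scope ring_scope.
Local Open Scope quotient_scope.

Definition gcast (P : nat -> nat -> Type) m m' n n' (em : m = m') (en : n = n')
    (p : P m n) : P m' n' :=
  ecast k (P k n') em (ecast k (P m k) en p).

(* The product e <-> (e <-> ...) of n.+1 copies of [e], parenthesized to the
   right so that its grade is convertible to (n.+1, n.+1). *)
Fixpoint hpow (P : nat -> nat -> Type)
    (h : forall m n m' n', P m n -> P m' n' -> P (m + m')%N (n + n')%N)
    (e : P 1 1) (n : nat) : P n.+1 n.+1 :=
  if n is k.+1 then h 1 1 k.+1 k.+1 e (hpow h e k) else e.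

(* Two sides of a law whose grades are equal but not convertible are compared
   through [gcast].  The unit [eps] of horizontal composition can only live in
   grade (0, 0). *)
Record pro_on (P : nat -> nat -> Type) := ProOn {
  hcomp : forall m n m' n', P m n -> P m' n' -> P (m + m')%N (n + n')%N;
  vcomp : forall m n p, P m n -> P n p -> P m p;
  idp : forall n, P n n;
  eps : P 0 0;
  hcompA : forall m n m' n' m'' n''
      (p : P m n) (q : P m' n') (r : P m'' n''),
    gcast (addnA m m' m'') (addnA n n' n'') (hcomp p (hcomp q r)) =
    hcomp (hcomp p q) r;
  vcompA : forall m n p q (x : P m n) (y : P n p) (z : P p q),
    vcomp x (vcomp y z) = vcomp (vcomp x y) z;
  interchange : forall m n r m' n' r'
      (p : P m n) (q : P n r) (p' : P m' n') (q' : P n' r'),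
    hcomp (vcomp p q) (vcomp p' q') = vcomp (hcomp p p') (hcomp q q');
  vcomp1p : forall m n (p : P m n), vcomp (idp m) p = p;
  vcompp1 : forall m n (p : P m n), vcomp p (idp n) = p;
  idp_hpow : forall n, idp n.+1 = hpow hcomp (idp 1) n;
  hcompep : forall m n (p : P m n), hcomp eps p = p;
  hcomppe : forall m n (p : P m n),
    gcast (addn0 m) (addn0 n) (hcomp p eps) = p
}.

Lemma idp_unique (P : nat -> nat -> Type) (S : pro_on P)
    (e : forall n, P n n) :
  (forall m n (p : P m n), vcomp S (e m) p = p) -> forall n, e n = idp S n.
Proof. by move=> e1 n; rewrite -[LHS](vcompp1 S) e1. Qed.

Record pro_morphism (P Q : nat -> nat -> Type) (SP : pro_on P) (SQ : pro_on Q)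
    (f : forall m n, P m n -> Q m n) : Prop := ProMorphism {
  pro_morph_hcomp : forall m n m' n' (p : P m n) (q : P m' n'),
    f _ _ (hcomp SP p q) = hcomp SQ (f _ _ p) (f _ _ q);
  pro_morph_vcomp : forall m n r (p : P m n) (q : P n r),
    f _ _ (vcomp SP p q) = vcomp SQ (f _ _ p) (f _ _ q);
  pro_morph_id : forall n, f _ _ (idp SP n) = idp SQ n
}.

Definition pro_isomorphism (P Q : nat -> nat -> Type)
    (SP : pro_on P) (SQ : pro_on Q) (f : forall m n, P m n -> Q m n) : Prop :=
  pro_morphism SP SQ f /\
  exists2 g : forall m n, Q m n -> P m n, pro_morphism SQ SP g &
    forall m n, cancel (@f m n) (@g m n) /\ cancel (@g m n) (@f m n).

Record bilinear_op (K : pzSemiRingType) (A B C : lSemiModType K)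
    (h : A -> B -> C) : Prop := BilinearOp {
  bilDl : forall a a' b, h (a + a') b = h a b + h a' b;
  bilDr : forall a b b', h a (b + b') = h a b + h a b';
  bilZl : forall k a b, h (k *: a) b = k *: h a b;
  bilZr : forall k a b, h a (k *: b) = k *: h a b
}.

Record modpro (K : comPzSemiRingType) := ModPro {
  mp_car :> nat -> nat -> lSemiModType K;
  mp_pro : pro_on mp_car;
  mp_hbil : forall m n m' n', bilinear_op (@hcomp _ mp_pro m n m' n');
  mp_vbil : forall m n p, bilinear_op (@vcomp _ mp_pro m n p)
}.

Definition modpro_isomorphic (K : comPzSemiRingType) (X Y : modpro K) : Prop :=
  exists f : forall m n, {linear X m n -> Y m n},
    pro_isomorphism (mp_pro X) (mp_pro Y) (fun m n x => f m n x).

Section BilinearTheory.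
Variables (K : pzSemiRingType) (A B C : lSemiModType K) (h : A -> B -> C).
Hypothesis hb : bilinear_op h.

Lemma bil0l b : h 0 b = 0.
Proof. by rewrite -(scale0r (0 : A)) bilZl // scale0r. Qed.

Lemma bil0r a : h a 0 = 0.
Proof. by rewrite -(scale0r (0 : B)) bilZr // scale0r. Qed.

End BilinearTheory.

Section Tensor.
Variables (K : comPzSemiRingType) (A B : lSemiModType K).

(* The list [:: (a1, b1); ..; (an, bn)] is read as a formal sum of pairs.  This
   is the congruence on formal sums generated by commutativity and the
   bilinearity relations; there is no subtraction, so the relations for 0 do
   not follow from additivity. *)
Inductive tens_cong : seq (A * B) -> seq (A * B) -> Prop :=
| tens_refl s : tens_cong s s
| tens_sym s t : tens_cong s t -> tens_cong t s
| tens_trans s t u : tens_cong s t -> tens_cong t u -> tens_cong s u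
| tens_cat s s' t t' :
    tens_cong s s' -> tens_cong t t' -> tens_cong (s ++ t) (s' ++ t')
| tens_catC s t : tens_cong (s ++ t) (t ++ s)
| tens_Dl a a' b : tens_cong [:: (a + a', b)] [:: (a, b); (a', b)]
| tens_Dr a b b' : tens_cong [:: (a, b + b')] [:: (a, b); (a, b')]
| tens_0l b : tens_cong [:: (0, b)] [::]
| tens_0r a : tens_cong [:: (a, 0)] [::]
| tens_Z k a b : tens_cong [:: (k *: a, b)] [:: (a, k *: b)].

Definition tens_congb (s t : seq (A * B)) : bool := `[< tens_cong s t >].

Lemma tens_congb_refl : reflexive tens_congb.
Proof. by move=> s; apply/asboolP/tens_refl. Qed.

Lemma tens_congb_sym : symmetric tens_congb.
Proof.
by move=> s t; apply/asboolP/asboolP => st; apply: tens_sym.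
Qed.

Lemma tens_congb_trans : transitive tens_congb.
Proof.
by move=> t s u /asboolP st /asboolP tu; apply/asboolP/(tens_trans st tu).
Qed.

Canonical tens_equiv :=
  EquivRel tens_congb tens_congb_refl tens_congb_sym tens_congb_trans.

Definition tensor := {eq_quot tens_equiv}.

HB.instance Definition _ := Choice.on tensor.
HB.instance Definition _ := Quotient.on tensor.
HB.instance Definition _ := EqQuotient.on tensor.

Lemma tens_piP s t : reflect (\pi_tensor s = \pi_tensor t) (tens_congb s t).
Proof. exact: eqmodP. Qed.

Lemma tens_pi s t : tens_cong s t -> \pi_tensor s = \pi_tensor t.
Proof. by move=> st; apply/tens_piP/asboolP. Qed.

Lemma tens_repr s : tens_cong (repr (\pi_tensor s)) s.
Proof. by apply/asboolP/tens_piP; rewrite reprK. Qed.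

Definition tens (a : A) (b : B) : tensor := \pi_tensor [:: (a, b)].

Definition tens_add (x y : tensor) : tensor := \pi_tensor (repr x ++ repr y).

Lemma tens_add_pi s t : tens_add (\pi s) (\pi t) = \pi_tensor (s ++ t).
Proof. by apply/tens_pi/tens_cat; apply: tens_repr. Qed.

Lemma tens_addA : associative tens_add.
Proof.
move=> x y z; rewrite -[x]reprK -[y]reprK -[z]reprK.
by rewrite !tens_add_pi catA.
Qed.

Lemma tens_addC : commutative tens_add.
Proof. by move=> x y; apply/tens_pi/tens_catC. Qed.

Lemma tens_add0 : left_id (\pi_tensor [::]) tens_add.
Proof. by move=> x; rewrite -[x]reprK tens_add_pi. Qed.

HB.instance Definition _ :=
  GRing.isNmodule.Build tensor tens_addA tens_addC tens_add0.

Lemma tens_pi_cat s t : \pi_tensor (s ++ t) = \pi_tensor s + \pi_tensor t.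
Proof. by rewrite -tens_add_pi. Qed.

Lemma tens_pi_sum s : \pi_tensor s = \sum_(ab <- s) tens ab.1 ab.2.
Proof.
elim: s => [|[a b] s IHs]; first by rewrite big_nil.
by rewrite big_cons -IHs -cat1s tens_pi_cat.
Qed.

Definition scale_word (k : K) (s : seq (A * B)) : seq (A * B) :=
  [seq (k *: ab.1, ab.2) | ab <- s].

Lemma scale_word_cong k s t :
  tens_cong s t -> tens_cong (scale_word k s) (scale_word k t).
Proof.
elim=> {s t}.
- by move=> *; apply: tens_refl.
- by move=> s t _; apply: tens_sym.
- by move=> s t u _ st _; apply: tens_trans.
- by move=> s s' t t' _ ss' _ tt'; rewrite /scale_word !map_cat; apply: tens_cat.
- by move=> s t; rewrite /scale_word !map_cat; apply: tens_catC.
- by move=> a a' b; rewrite /= scalerDr; apply: tens_Dl.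
- by move=> a b b'; apply: tens_Dr.
- by move=> b; rewrite /= scaler0; apply: tens_0l.
- by move=> a; apply: tens_0r.
- by move=> l a b; rewrite /= scalerA mulrC -scalerA; apply: tens_Z.
Qed.

Definition tens_scale (k : K) (x : tensor) : tensor :=
  \pi_tensor (scale_word k (repr x)).

Lemma tens_scale_pi k s : tens_scale k (\pi s) = \pi_tensor (scale_word k s).
Proof. by apply/tens_pi/scale_word_cong/tens_repr. Qed.

Lemma tens_scaleA a b x :
  tens_scale a (tens_scale b x) = tens_scale (a * b) x.
Proof.
rewrite -[x]reprK !tens_scale_pi /scale_word -map_comp.
by congr \pi; apply: eq_map => -[u v] /=; rewrite scalerA.
Qed.

Lemma tens_scale0 x : tens_scale 0 x = 0.
Proof.
rewrite -[x]reprK tens_scale_pi; elim: (repr x) => [//|[a b] s IHs].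
rewrite /= scale0r -cat1s tens_pi_cat IHs addr0.
exact/tens_pi/tens_0l.
Qed.

Lemma tens_scale1 : left_id 1 tens_scale.
Proof.
move=> x; rewrite -[x]reprK tens_scale_pi /scale_word; congr \pi.
by rewrite -[RHS]map_id; apply: eq_map => -[u v] /=; rewrite scale1r.
Qed.

Lemma tens_scaleDr : right_distributive tens_scale +%R.
Proof.
move=> k x y; rewrite -[x]reprK -[y]reprK -tens_pi_cat !tens_scale_pi.
by rewrite /scale_word map_cat tens_pi_cat.
Qed.

Lemma tens_scaleDl x : {morph tens_scale^~ x : a b / a + b}.
Proof.
move=> k l /=; rewrite -[x]reprK !tens_scale_pi.
elim: (repr x) => [|[a b] s IHs]; first by rewrite /= addr0.
rewrite /= -![(_, _) :: scale_word _ _]cat1s !tens_pi_cat IHs addrACA.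
congr (_ + _); rewrite scalerDl -tens_pi_cat.
exact/tens_pi/tens_Dl.
Qed.

HB.instance Definition _ := GRing.Nmodule_isLSemiModule.Build K tensor
  tens_scaleA tens_scale0 tens_scale1 tens_scaleDr tens_scaleDl.

Lemma tens_bilinear : bilinear_op tens.
Proof.
split=> [a a' b|a b b'|k a b|k a b].
- by rewrite -tens_pi_cat; apply/tens_pi/tens_Dl.
- by rewrite -tens_pi_cat; apply/tens_pi/tens_Dr.
- by rewrite [RHS]tens_scale_pi.
- by rewrite [RHS]tens_scale_pi; apply/tens_pi/tens_sym/tens_Z.
Qed.

Lemma tens_ind (Q : tensor -> Prop) :
  Q 0 -> (forall x y, Q x -> Q y -> Q (x + y)) -> (forall a b, Q (tens a b)) ->
  forall x, Q x.
Proof.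
by move=> Q0 QD Qt x; rewrite -[x]reprK tens_pi_sum; apply: big_ind.
Qed.

(* For a bilinear [f], this is the linear map through which [f] factors. *)
Definition tlift (C : lSemiModType K) (f : A -> B -> C) (x : tensor) : C :=
  \sum_(ab <- repr x) f ab.1 ab.2.

Section Lift.
Variables (C : lSemiModType K) (f : A -> B -> C).
Hypothesis fb : bilinear_op f.

Lemma tlift_cong s t : tens_cong s t ->
  \sum_(ab <- s) f ab.1 ab.2 = \sum_(ab <- t) f ab.1 ab.2.
Proof.
elim=> {s t}.
- by [].
- by move=> s t _ ->.
- by move=> s t u _ -> _ ->.
- by move=> s s' t t' _ e _ e'; rewrite !big_cat /= e e'.
- by move=> s t; rewrite !big_cat /= addrC.
- by move=> a a' b; rewrite !big_cons !big_nil /= !addr0 (bilDl fb).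
- by move=> a b b'; rewrite !big_cons !big_nil /= !addr0 (bilDr fb).
- by move=> b; rewrite big_seq1 big_nil (bil0l fb).
- by move=> b; rewrite big_seq1 big_nil (bil0r fb).
- by move=> k a b; rewrite !big_seq1 /= (bilZl fb) (bilZr fb).
Qed.

Lemma tlift_pi s : tlift f (\pi_tensor s) = \sum_(ab <- s) f ab.1 ab.2.
Proof. exact/tlift_cong/tens_repr. Qed.

Lemma tliftE a b : tlift f (tens a b) = f a b.
Proof. by rewrite tlift_pi big_seq1. Qed.

Lemma tliftD x y : tlift f (x + y) = tlift f x + tlift f y.
Proof.
by rewrite -[x]reprK -[y]reprK -tens_pi_cat !tlift_pi big_cat.
Qed.

Lemma tliftZ k x : tlift f (k *: x) = k *: tlift f x.
Proof.
rewrite -[x]reprK [X in tlift f X]tens_scale_pi !tlift_pi big_map scaler_sumr.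
by apply: eq_bigr => ab _; rewrite (bilZl fb).
Qed.

Lemma tlift0 : tlift f 0 = 0.
Proof. by rewrite tlift_pi big_nil. Qed.

End Lift.
End Tensor.

Section TensorOp.
Variables (K : comPzSemiRingType) (A B C A' B' C' : lSemiModType K).
Variables (h : A -> B -> C) (h' : A' -> B' -> C').

Definition tens_op (x : tensor A A') (y : tensor B B') : tensor C C' :=
  tlift (fun a a' => tlift (fun b b' => tens (h a b) (h' a' b')) y) x.

Hypotheses (hb : bilinear_op h) (hb' : bilinear_op h').

Lemma tens_op_inner_bil a a' : bilinear_op (fun b b' => tens (h a b) (h' a' b')).
Proof.
have tb := tens_bilinear C C'; split=> [b b1 b'|b b' b1|k b b'|k b b'].
- by rewrite (bilDr hb) (bilDl tb).
- by rewrite (bilDr hb') (bilDr tb).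
- by rewrite (bilZr hb) (bilZl tb).
- by rewrite (bilZr hb') (bilZr tb).
Qed.

Lemma tens_op_outer_bil y :
  bilinear_op (fun a a' => tlift (fun b b' => tens (h a b) (h' a' b')) y).
Proof.
have tb := tens_bilinear C C'; have ib := tens_op_inner_bil.
split=> [a a1 a'|a a' a1|k a a'|k a a']; elim/tens_ind: y;
  rewrite ?tlift0 ?addr0 ?scaler0 //;
  try by [move=> x y ex ey; rewrite !tliftD // ex ey ?scalerDr // addrACA].
- by move=> b b'; rewrite !tliftE // (bilDl hb) (bilDl tb).
- by move=> b b'; rewrite !tliftE // (bilDl hb') (bilDr tb).
- by move=> b b'; rewrite !tliftE // (bilZl hb) (bilZl tb).
- by move=> b b'; rewrite !tliftE // (bilZl hb') (bilZr tb).
Qed.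

Lemma tens_opE a a' b b' :
  tens_op (tens a a') (tens b b') = tens (h a b) (h' a' b').
Proof.
rewrite /tens_op tliftE; first exact: tliftE (tens_op_inner_bil _ _) _ _.
exact: tens_op_outer_bil.
Qed.

Lemma tens_op_bil : bilinear_op tens_op.
Proof.
have ib := tens_op_inner_bil; have ob := tens_op_outer_bil.
split=> [x y z|x y z|k x y|k x y]; rewrite /tens_op.
- by rewrite tliftD.
- elim/tens_ind: x => [|x x' ex ex'|a a']; rewrite ?tlift0 ?addr0 //.
    by rewrite !tliftD // ex ex' addrACA.
  by rewrite !tliftE // tliftD.
- by rewrite tliftZ.
- elim/tens_ind: x => [|x x' ex ex'|a a']; rewrite ?tlift0 ?scaler0 //.
    by rewrite !tliftD // ex ex' scalerDr.
  by rewrite !tliftE // tliftZ.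
Qed.

End TensorOp.

Lemma gcastD (K : comPzSemiRingType) (X : nat -> nat -> lSemiModType K)
    m m' n n' (em : m = m') (en : n = n') (x y : X m n) :
  gcast (P := X) em en (x + y) =
  gcast (P := X) em en x + gcast (P := X) em en y.
Proof. by case: m' / em; case: n' / en. Qed.

Lemma gcast0 (K : comPzSemiRingType) (X : nat -> nat -> lSemiModType K)
    m m' n n' (em : m = m') (en : n = n') :
  gcast (P := X) em en 0 = 0.
Proof. by case: m' / em; case: n' / en. Qed.

Section TensorModPro.
Variables (K : comPzSemiRingType) (X Y : modpro K).

Definition tensor_car (m n : nat) : lSemiModType K := tensor (X m n) (Y m n).

Local Notation T := tensor_car.
Local Notation SX := (mp_pro X).
Local Notation SY := (mp_pro Y).

Lemma tensor_car_ind m n (Q : T m n -> Prop) :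
  Q 0 -> (forall x y, Q x -> Q y -> Q (x + y)) ->
  (forall (a : X m n) (b : Y m n), Q (tens a b)) -> forall x, Q x.
Proof. exact: tens_ind. Qed.

Definition tensor_hcomp m n m' n' :
    T m n -> T m' n' -> T (m + m')%N (n + n')%N :=
  tens_op (@hcomp _ SX m n m' n') (@hcomp _ SY m n m' n').
Definition tensor_vcomp m n p : T m n -> T n p -> T m p :=
  tens_op (@vcomp _ SX m n p) (@vcomp _ SY m n p).
Definition tensor_id n : T n n := tens (idp SX n) (idp SY n).
Definition tensor_eps : T 0 0 := tens (eps SX) (eps SY).

Lemma tensor_hbil m n m' n' : bilinear_op (@tensor_hcomp m n m' n').
Proof. by apply: tens_op_bil; apply: mp_hbil. Qed.
Lemma tensor_vbil m n p : bilinear_op (@tensor_vcomp m n p).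
Proof. by apply: tens_op_bil; apply: mp_vbil. Qed.

Lemma tensor_hcompE m n m' n'
    (a : X m n) (a' : Y m n) (b : X m' n') (b' : Y m' n') :
  tensor_hcomp (tens a a') (tens b b') = tens (hcomp SX a b) (hcomp SY a' b').
Proof. by apply: tens_opE; apply: mp_hbil. Qed.
Lemma tensor_vcompE m n p (a : X m n) (a' : Y m n) (b : X n p) (b' : Y n p) :
  tensor_vcomp (tens a a') (tens b b') = tens (vcomp SX a b) (vcomp SY a' b').
Proof. by apply: tens_opE; apply: mp_vbil. Qed.

Lemma gcast_tens m m' n n' (em : m = m') (en : n = n') (a : X m n) (b : Y m n) :
  gcast (P := T) em en (tens a b) =
  tens (gcast (P := mp_car X) em en a) (gcast (P := mp_car Y) em en b).
Proof. by case: m' / em; case: n' / en. Qed.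

Lemma tensor_hcomp0l m n m' n' y : @tensor_hcomp m n m' n' 0 y = 0.
Proof. exact: bil0l (tensor_hbil _ _ _ _) _. Qed.
Lemma tensor_hcomp0r m n m' n' x : @tensor_hcomp m n m' n' x 0 = 0.
Proof. exact: bil0r (tensor_hbil _ _ _ _) _. Qed.
Lemma tensor_vcomp0l m n p y : @tensor_vcomp m n p 0 y = 0.
Proof. exact: bil0l (tensor_vbil _ _ _) _. Qed.
Lemma tensor_vcomp0r m n p x : @tensor_vcomp m n p x 0 = 0.
Proof. exact: bil0r (tensor_vbil _ _ _) _. Qed.

Lemma tensor_hcompDl m n m' n' x x' y :
  @tensor_hcomp m n m' n' (x + x') y = tensor_hcomp x y + tensor_hcomp x' y.
Proof. exact: bilDl (tensor_hbil _ _ _ _) _ _ _. Qed.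
Lemma tensor_hcompDr m n m' n' x y y' :
  @tensor_hcomp m n m' n' x (y + y') = tensor_hcomp x y + tensor_hcomp x y'.
Proof. exact: bilDr (tensor_hbil _ _ _ _) _ _ _. Qed.
Lemma tensor_vcompDl m n p x x' y :
  @tensor_vcomp m n p (x + x') y = tensor_vcomp x y + tensor_vcomp x' y.
Proof. exact: bilDl (tensor_vbil _ _ _) _ _ _. Qed.
Lemma tensor_vcompDr m n p x y y' :
  @tensor_vcomp m n p x (y + y') = tensor_vcomp x y + tensor_vcomp x y'.
Proof. exact: bilDr (tensor_vbil _ _ _) _ _ _. Qed.

Local Notation simp0 := (tensor_hcomp0l, tensor_hcomp0r, tensor_vcomp0l,
  tensor_vcomp0r, @gcast0 K T).
Local Notation simpD := (tensor_hcompDl, tensor_hcompDr, tensor_vcompDl,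
  tensor_vcompDr, @gcastD K T).

Lemma tensor_hcompA m n m' n' m'' n''
    (p : T m n) (q : T m' n') (r : T m'' n'') :
  gcast (P := T) (addnA m m' m'') (addnA n n' n'')
    (tensor_hcomp p (tensor_hcomp q r)) =
  tensor_hcomp (tensor_hcomp p q) r.
Proof.
elim/tensor_car_ind: p => [|p p' e e'|a a']; rewrite ?simp0 ?simpD ?e ?e' //.
elim/tensor_car_ind: q => [|q q' e e'|b b'];
  rewrite ?simp0 ?simpD ?simp0 ?e ?e' //.
elim/tensor_car_ind: r => [|r r' e e'|c c']; rewrite ?simp0 ?simpD ?e ?e' //.
by rewrite !tensor_hcompE gcast_tens !hcompA.
Qed.

Lemma tensor_vcompA m n p q (x : T m n) (y : T n p) (z : T p q) :
  tensor_vcomp x (tensor_vcomp y z) = tensor_vcomp (tensor_vcomp x y) z.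
Proof.
elim/tensor_car_ind: x => [|x x' e e'|a a']; rewrite ?simp0 ?simpD ?e ?e' //.
elim/tensor_car_ind: y => [|y y' e e'|b b'];
  rewrite ?simp0 ?simpD ?simp0 ?e ?e' //.
elim/tensor_car_ind: z => [|z z' e e'|c c']; rewrite ?simp0 ?simpD ?e ?e' //.
by rewrite !tensor_vcompE !vcompA.
Qed.

Lemma tensor_interchange m n r m' n' r'
    (p : T m n) (q : T n r) (p' : T m' n') (q' : T n' r') :
  tensor_hcomp (tensor_vcomp p q) (tensor_vcomp p' q') =
  tensor_vcomp (tensor_hcomp p p') (tensor_hcomp q q').
Proof.
elim/tensor_car_ind: p => [|x x' e e'|a a']; rewrite ?simp0 ?simpD ?e ?e' //.
elim/tensor_car_ind: q => [|x x' e e'|b b']; rewrite ?simp0 ?simpD ?e ?e' //.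
elim/tensor_car_ind: p' => [|x x' e e'|c c']; rewrite ?simp0 ?simpD ?e ?e' //.
elim/tensor_car_ind: q' => [|x x' e e'|d d']; rewrite ?simp0 ?simpD ?e ?e' //.
by rewrite !tensor_vcompE !tensor_hcompE !tensor_vcompE !interchange.
Qed.

Lemma tensor_vcomp1p m n (p : T m n) : tensor_vcomp (tensor_id m) p = p.
Proof.
elim/tensor_car_ind: p => [|x x' e e'|a a']; rewrite ?simp0 ?simpD ?e ?e' //.
by rewrite tensor_vcompE !vcomp1p.
Qed.

Lemma tensor_vcompp1 m n (p : T m n) : tensor_vcomp p (tensor_id n) = p.
Proof.
elim/tensor_car_ind: p => [|x x' e e'|a a']; rewrite ?simp0 ?simpD ?e ?e' //.
by rewrite tensor_vcompE !vcompp1.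
Qed.

Lemma tensor_id_hpow n : tensor_id n.+1 = hpow tensor_hcomp (tensor_id 1) n.
Proof.
rewrite /tensor_id (idp_hpow SX) (idp_hpow SY).
elim: n => [//|n IHn] /=.
by rewrite -IHn (@tensor_hcompE 1 1 n.+1 n.+1).
Qed.

Lemma tensor_hcompep m n (p : T m n) : tensor_hcomp tensor_eps p = p.
Proof.
elim/tensor_car_ind: p => [|x x' e e'|a a']; rewrite ?simp0 ?simpD ?e ?e' //.
by rewrite tensor_hcompE !hcompep.
Qed.

Lemma tensor_hcomppe m n (p : T m n) :
  gcast (P := T) (addn0 m) (addn0 n) (tensor_hcomp p tensor_eps) = p.
Proof.
elim/tensor_car_ind: p => [|x x' e e'|a a']; rewrite ?simp0 ?simpD ?e ?e' //.
by rewrite tensor_hcompE gcast_tens !hcomppe.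
Qed.

Definition tensor_pro : pro_on tensor_car :=
  @ProOn T tensor_hcomp tensor_vcomp tensor_id tensor_eps tensor_hcompA
    tensor_vcompA tensor_interchange tensor_vcomp1p tensor_vcompp1
    tensor_id_hpow tensor_hcompep tensor_hcomppe.

Definition tensor_modpro : modpro K :=
  @ModPro K T tensor_pro tensor_hbil tensor_vbil.

End TensorModPro.

Section MultiIndex.
Variable N : nat.

Definition lidx m n (I : 'I_N ^ (m + n)) : 'I_N ^ m :=
  [ffun i => I (lshift n i)].
Definition ridx m n (I : 'I_N ^ (m + n)) : 'I_N ^ n :=
  [ffun i => I (rshift m i)].
Definition catidx m n (I : 'I_N ^ m) (I' : 'I_N ^ n) : 'I_N ^ (m + n) :=
  [ffun k => match split k with inl i => I i | inr i => I' i end].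

Lemma lidx_cat m n (I : 'I_N ^ m) (I' : 'I_N ^ n) : lidx (catidx I I') = I.
Proof. by apply/ffunP=> i; rewrite !ffunE (unsplitK (inl i)). Qed.

Lemma ridx_cat m n (I : 'I_N ^ m) (I' : 'I_N ^ n) : ridx (catidx I I') = I'.
Proof. by apply/ffunP=> i; rewrite !ffunE (unsplitK (inr i)). Qed.

Lemma catidxK m n (I : 'I_N ^ (m + n)) : catidx (lidx I) (ridx I) = I.
Proof.
apply/ffunP=> k; rewrite ffunE -[in RHS](splitK k).
by case: (split k) => i; rewrite ffunE.
Qed.

Definition castidx m n (e : m = n) (I : 'I_N ^ n) : 'I_N ^ m :=
  [ffun i => I (cast_ord e i)].

Lemma castidx_id m (e : m = m) (I : 'I_N ^ m) : castidx e I = I.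
Proof. by apply/ffunP=> i; rewrite ffunE cast_ord_id. Qed.

Lemma eq_catidx m n (I J : 'I_N ^ (m + n)) :
  (I == J) = (lidx I == lidx J) && (ridx I == ridx J).
Proof.
apply/eqP/andP => [->//|[/eqP el /eqP er]].
by rewrite -[I]catidxK el er catidxK.
Qed.

Lemma idx0 (I J : 'I_N ^ 0) : I = J.
Proof. by apply/ffunP=> -[]. Qed.

End MultiIndex.

Section Hypermatrix.
Variables (K : comPzSemiRingType) (N : nat).

(* The multi-index [I : 'I_N ^ p] is a word of length p, and the entry of [A]
   with upper index I and lower index J is [A (I, J)]. *)
Definition hypermx (p q : nat) : lSemiModType K :=
  {ffun ('I_N ^ p) * ('I_N ^ q) -> K^o}.

Definition hmx_hcomp p q p' q' (A : hypermx p q) (B : hypermx p' q') :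
    hypermx (p + p')%N (q + q')%N :=
  [ffun IJ => (A (lidx IJ.1, lidx IJ.2) : K) * B (ridx IJ.1, ridx IJ.2)].

Definition hmx_vcomp p q r (A : hypermx p q) (B : hypermx q r) : hypermx p r :=
  [ffun IJ => \sum_(L : 'I_N ^ q) (A (IJ.1, L) : K) * B (L, IJ.2)].

Definition hmx_id n : hypermx n n := [ffun IJ => (IJ.1 == IJ.2)%:R : K].

Definition hmx_eps : hypermx 0 0 := [ffun=> 1 : K].

Lemma hmx_hcompE p q p' q' (A : hypermx p q) (B : hypermx p' q') I J I' J' :
  hmx_hcomp A B (catidx I I', catidx J J') = (A (I, J) : K) * B (I', J').
Proof. by rewrite ffunE /= !lidx_cat !ridx_cat. Qed.

Lemma hmx_hbil p q p' q' : bilinear_op (@hmx_hcomp p q p' q').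
Proof.
split=> [a a' b|a b b'|k a b|k a b]; apply/ffunP=> IJ; rewrite !ffunE.
- by rewrite mulrDl.
- by rewrite mulrDr.
- by rewrite /GRing.scale /= mulrA.
- by rewrite /GRing.scale /= mulrCA.
Qed.

Lemma hmx_vbil p q r : bilinear_op (@hmx_vcomp p q r).
Proof.
split=> [a a' b|a b b'|k a b|k a b]; apply/ffunP=> IJ; rewrite !ffunE.
- by rewrite -big_split; apply: eq_bigr => L _; rewrite ffunE mulrDl.
- by rewrite -big_split; apply: eq_bigr => L _; rewrite ffunE mulrDr.
- rewrite scaler_sumr; apply: eq_bigr => L _.
  by rewrite ffunE /GRing.scale /= mulrA.
- rewrite scaler_sumr; apply: eq_bigr => L _.
  by rewrite ffunE /GRing.scale /= mulrCA.
Qed.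

Lemma gcast_hmx p p' q q' (ep : p = p') (eq : q = q') (A : hypermx p q) I J :
  gcast (P := hypermx) ep eq A (I, J) = A (castidx ep I, castidx eq J).
Proof. by case: p' / ep I; case: q' / eq J => J I; rewrite !castidx_id. Qed.

Lemma castidxA m n p (I : 'I_N ^ (m + n + p)) :
  [/\ lidx (castidx (addnA m n p) I) = lidx (lidx I),
      lidx (ridx (castidx (addnA m n p) I)) = ridx (lidx I) &
      ridx (ridx (castidx (addnA m n p) I)) = ridx I].
Proof.
by split; apply/ffunP=> i; rewrite !ffunE; congr (I _); apply/val_inj;
  rewrite //= addnA.
Qed.

Lemma castidx0 m (I : 'I_N ^ m) : lidx (castidx (addn0 m) I) = I.
Proof. by apply/ffunP=> i; rewrite !ffunE; congr (I _); apply/val_inj. Qed.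

Lemma hmx_hcompA m n m' n' m'' n''
    (p : hypermx m n) (q : hypermx m' n') (r : hypermx m'' n'') :
  gcast (P := hypermx) (addnA m m' m'') (addnA n n' n'')
    (hmx_hcomp p (hmx_hcomp q r)) =
  hmx_hcomp (hmx_hcomp p q) r.
Proof.
apply/ffunP=> -[I J]; rewrite gcast_hmx !ffunE /=.
have [-> -> ->] := castidxA I; have [-> -> ->] := castidxA J.
by rewrite mulrA.
Qed.

Lemma hmx_vcompA m n p q (x : hypermx m n) (y : hypermx n p) (z : hypermx p q) :
  hmx_vcomp x (hmx_vcomp y z) = hmx_vcomp (hmx_vcomp x y) z.
Proof.
apply/ffunP=> IJ; rewrite !ffunE.
under eq_bigr do rewrite ffunE mulr_sumr.
rewrite exchange_big; apply: eq_bigr => L _ /=.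
by rewrite ffunE mulr_suml; apply: eq_bigr => L' _; rewrite mulrA.
Qed.

Lemma hmx_interchange m n r m' n' r' (p : hypermx m n) (q : hypermx n r)
    (p' : hypermx m' n') (q' : hypermx n' r') :
  hmx_hcomp (hmx_vcomp p q) (hmx_vcomp p' q') =
  hmx_vcomp (hmx_hcomp p p') (hmx_hcomp q q').
Proof.
apply/ffunP=> IJ; rewrite !ffunE /= big_distrlr pair_big /=.
rewrite [RHS](reindex (fun L : ('I_N ^ n) * ('I_N ^ n') => catidx L.1 L.2)) /=.
  by apply: eq_bigr => -[L L'] _; rewrite !ffunE /= !lidx_cat !ridx_cat mulrACA.
exists (fun L => (lidx L, ridx L)) => [[L L']|L] _ /=.
  by rewrite lidx_cat ridx_cat.
exact: catidxK.
Qed.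

Lemma hmx_vcomp1p m n (p : hypermx m n) : hmx_vcomp (hmx_id m) p = p.
Proof.
apply/ffunP=> -[I J]; rewrite ffunE /= (bigD1 I) //= big1 => [|L neL].
  by rewrite ffunE eqxx mul1r addr0.
by rewrite ffunE /= eq_sym (negPf neL) mul0r.
Qed.

Lemma hmx_vcompp1 m n (p : hypermx m n) : hmx_vcomp p (hmx_id n) = p.
Proof.
apply/ffunP=> -[I J]; rewrite ffunE /= (bigD1 J) //= big1 => [|L neL].
  by rewrite ffunE eqxx mulr1 addr0.
by rewrite ffunE /= (negPf neL) mulr0.
Qed.

Lemma hmx_id_hpow n : hmx_id n.+1 = hpow hmx_hcomp (hmx_id 1) n.
Proof.
elim: n => [//|n IHn] /=; rewrite -IHn.
apply/ffunP=> -[I J]; rewrite !ffunE /=.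
by rewrite (@eq_catidx N 1 n.+1) -natrM mulnb.
Qed.

Lemma hmx_hcompep m n (p : hypermx m n) : hmx_hcomp hmx_eps p = p.
Proof.
apply/ffunP=> -[I J]; rewrite !ffunE mul1r /=.
by congr (p (_, _)); apply/ffunP=> i; rewrite ffunE; congr (_ _); apply/val_inj.
Qed.

Lemma hmx_hcomppe m n (p : hypermx m n) :
  gcast (P := hypermx) (addn0 m) (addn0 n) (hmx_hcomp p hmx_eps) = p.
Proof.
by apply/ffunP=> -[I J]; rewrite gcast_hmx !ffunE mulr1 /= !castidx0.
Qed.

Definition hypermx_pro : pro_on hypermx :=
  @ProOn hypermx hmx_hcomp hmx_vcomp hmx_id hmx_eps hmx_hcompA hmx_vcompA
    hmx_interchange hmx_vcomp1p hmx_vcompp1 hmx_id_hpow hmx_hcompep hmx_hcomppe.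

Definition hypermx_modpro : modpro K :=
  @ModPro K hypermx hypermx_pro hmx_hbil hmx_vbil.

End Hypermatrix.

(* Main.v *)
From HB Require Import structures.
Require Import Defs.
From mathcomp Require Import all_boot all_algebra.

Set Implicit Arguments.
Unset Strict Implicit.
Unset Printing Implicit Defensive.

Import GRing.Theory.
Local Open Scope ring_scope.

(** Fix a bijection between [MN] and [M] x [N].  Applied letter by letter it
    turns a multi-index over [MN] into a pair of multi-indices over [M] and [N]
    of the same length, and it commutes with concatenation.  The isomorphism is
    the Kronecker product: [A] tensor [B] goes to the hypermatrix whose entry at
    (I, J) is the product of the entries of [A] and [B] at the two components
    of (I, J).

    Horizontal composition is preserved because both sides multiply the same
    four entries ([kron_hcomp]); vertical composition because a product of a
    sum over multi-indices L of [M] and a sum over multi-indices L' of [N] is a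
    sum over multi-indices of [MN], by distributivity ([kron_vcomp]).

    Each component of a hypermatrix PRO is a free module on the elementary
    hypermatrices, so no subtraction is needed to invert the map: its inverse
    sends [C] to the sum over (I, J) of C(I, J) times the tensor of the two
    elementary hypermatrices at the components of (I, J).  One composite is the
    expansion of [C] on elementary hypermatrices; the other one, on a pure
    tensor, is the product of the expansions of [A] and of [B], regrouped by
    bilinearity. *)

(** Compatibility of the inverse with the operations comes for free: apply the
    injective [f] to both sides and use that [f] itself is compatible. *)
Lemma bij_pro_isomorphism (P Q : nat -> nat -> Type)
    (SP : pro_on P) (SQ : pro_on Q) (f : forall m n, P m n -> Q m n)
    (g : forall m n, Q m n -> P m n) :
  pro_morphism SP SQ f -> (forall m n, cancel (@f m n) (@g m n)) ->
  (forall m n, cancel (@g m n) (@f m n)) -> pro_isomorphism SP SQ f.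
Proof.
move=> fmor fK gK; split=> //; exists g; last by split.
case: fmor => fh fv f1; split=> [m n m' n' p q|m n r p q|n].
- by apply: (can_inj (fK _ _)); rewrite fh !gK.
- by apply: (can_inj (fK _ _)); rewrite fv !gK.
- by apply: (can_inj (fK _ _)); rewrite f1 gK.
Qed.

(** * Bilinear operations *)

Lemma bil_suml (K : pzSemiRingType) (A B C : lSemiModType K) (h : A -> B -> C)
    (I : finType) (F : I -> A) b :
  bilinear_op h -> h (\sum_i F i) b = \sum_i h (F i) b.
Proof.
move=> hb; apply: (big_morph (h^~ b)) => [a a'|]; first exact: bilDl.
exact: bil0l.
Qed.

Lemma bil_sumr (K : pzSemiRingType) (A B C : lSemiModType K) (h : A -> B -> C)
    (I : finType) (F : I -> B) a :
  bilinear_op h -> h a (\sum_i F i) = \sum_i h a (F i).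
Proof.
move=> hb; apply: (big_morph (h a)) => [b b'|]; first exact: bilDr.
exact: bil0r.
Qed.

(** Pure tensors generate the tensor product additively.  Taking for [f] and [g]
    the two ways of composing two tensors and mapping the result to
    hypermatrices, this reduces the compatibility with either composition to an
    identity between Kronecker products. *)
Lemma tens_bil_ext (K : comPzSemiRingType)
    (A A' B B' C : lSemiModType K)
    (f g : tensor A A' -> tensor B B' -> C) :
  bilinear_op f -> bilinear_op g ->
  (forall a a' b b', f (tens a a') (tens b b') = g (tens a a') (tens b b')) ->
  forall x y, f x y = g x y.
Proof.
move=> fb gb e x y.
elim/tens_ind: x => [|x x' ex ex'|a a']; first by rewrite (bil0l fb) (bil0l gb).
  by rewrite (bilDl fb) (bilDl gb) ex ex'.
elim/tens_ind: y => [|y y' ey ey'|b b']; first by rewrite (bil0r fb) (bil0r gb).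
  by rewrite (bilDr fb) (bilDr gb) ey ey'.
exact: e.
Qed.

Lemma bil_comp_post (K : pzSemiRingType) (A B C D : lSemiModType K)
    (h : A -> B -> C) (f : {linear C -> D}) :
  bilinear_op h -> bilinear_op (fun a b => f (h a b)).
Proof.
move=> hb; split=> [a a' b|a b b'|k a b|k a b].
- by rewrite (bilDl hb) linearD.
- by rewrite (bilDr hb) linearD.
- by rewrite (bilZl hb) linearZ.
- by rewrite (bilZr hb) linearZ.
Qed.

Lemma bil_comp_pre (K : pzSemiRingType) (A B C A0 B0 : lSemiModType K)
    (h : A -> B -> C) (f : {linear A0 -> A}) (g : {linear B0 -> B}) :
  bilinear_op h -> bilinear_op (fun a b => h (f a) (g b)).
Proof.
move=> hb; split=> [a a' b|a b b'|k a b|k a b].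
- by rewrite linearD (bilDl hb).
- by rewrite linearD (bilDr hb).
- by rewrite linearZ (bilZl hb).
- by rewrite linearZ (bilZr hb).
Qed.

(** * Multi-indices over a product *)

Section ProductIndex.
Variables M N : nat.

Definition enc_ord (ab : 'I_M * 'I_N) : 'I_(M * N) := mxvec_index ab.1 ab.2.

Definition dec_ord (k : 'I_(M * N)) : 'I_M * 'I_N :=
  enum_val (cast_ord (esym (mxvec_cast M N)) k).

Lemma enc_ordK : cancel enc_ord dec_ord.
Proof. by case=> a b; rewrite /dec_ord cast_ordK enum_rankK. Qed.

Lemma dec_ordK : cancel dec_ord enc_ord.
Proof.
by move=> k; case/mxvec_indexP: k => a b; rewrite (enc_ordK (a, b)).
Qed.

Definition idx1 p (I : 'I_(M * N) ^ p) : 'I_M ^ p :=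
  [ffun i => (dec_ord (I i)).1].
Definition idx2 p (I : 'I_(M * N) ^ p) : 'I_N ^ p :=
  [ffun i => (dec_ord (I i)).2].
Definition pair_idx p (I : 'I_M ^ p) (I' : 'I_N ^ p) : 'I_(M * N) ^ p :=
  [ffun i => enc_ord (I i, I' i)].

Lemma idx1_pair p (I : 'I_M ^ p) (I' : 'I_N ^ p) : idx1 (pair_idx I I') = I.
Proof. by apply/ffunP=> i; rewrite !ffunE enc_ordK. Qed.

Lemma idx2_pair p (I : 'I_M ^ p) (I' : 'I_N ^ p) : idx2 (pair_idx I I') = I'.
Proof. by apply/ffunP=> i; rewrite !ffunE enc_ordK. Qed.

Lemma pair_idxK p (I : 'I_(M * N) ^ p) : pair_idx (idx1 I) (idx2 I) = I.
Proof. by apply/ffunP=> i; rewrite !ffunE -surjective_pairing dec_ordK. Qed.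

Lemma eq_idx p (I J : 'I_(M * N) ^ p) :
  (I == J) = (idx1 I == idx1 J) && (idx2 I == idx2 J).
Proof.
apply/eqP/andP => [->//|[/eqP e1 /eqP e2]].
by rewrite -[I]pair_idxK e1 e2 pair_idxK.
Qed.

Lemma idx1_lidx m n (I : 'I_(M * N) ^ (m + n)) : idx1 (lidx I) = lidx (idx1 I).
Proof. by apply/ffunP=> i; rewrite !ffunE. Qed.

Lemma idx1_ridx m n (I : 'I_(M * N) ^ (m + n)) : idx1 (ridx I) = ridx (idx1 I).
Proof. by apply/ffunP=> i; rewrite !ffunE. Qed.

Lemma idx2_lidx m n (I : 'I_(M * N) ^ (m + n)) : idx2 (lidx I) = lidx (idx2 I).
Proof. by apply/ffunP=> i; rewrite !ffunE. Qed.

Lemma idx2_ridx m n (I : 'I_(M * N) ^ (m + n)) : idx2 (ridx I) = ridx (idx2 I).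
Proof. by apply/ffunP=> i; rewrite !ffunE. Qed.

Definition biidx1 p q (U : ('I_(M * N) ^ p) * ('I_(M * N) ^ q)) :=
  (idx1 U.1, idx1 U.2).
Definition biidx2 p q (U : ('I_(M * N) ^ p) * ('I_(M * N) ^ q)) :=
  (idx2 U.1, idx2 U.2).

Lemma eq_biidx p q (U V : ('I_(M * N) ^ p) * ('I_(M * N) ^ q)) :
  (U == V) = (biidx1 U == biidx1 V) && (biidx2 U == biidx2 V).
Proof. by rewrite -!pair_eqE /pair_eq /= !eq_idx andbACA. Qed.

Lemma sum_idx (V : nmodType) p (F : 'I_M ^ p -> 'I_N ^ p -> V) :
  \sum_I \sum_J F I J = \sum_(L : 'I_(M * N) ^ p) F (idx1 L) (idx2 L).
Proof.
rewrite pair_bigA /= (reindex (fun L => (idx1 L, idx2 L))) //=.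
exists (fun IJ => pair_idx IJ.1 IJ.2) => [L|[I J]] _ /=; first exact: pair_idxK.
by rewrite idx1_pair idx2_pair.
Qed.

Lemma sum_biidx (V : nmodType) p q
    (F : ('I_M ^ p) * ('I_M ^ q) -> ('I_N ^ p) * ('I_N ^ q) -> V) :
  \sum_A \sum_B F A B =
  \sum_(U : ('I_(M * N) ^ p) * ('I_(M * N) ^ q)) F (biidx1 U) (biidx2 U).
Proof.
rewrite pair_bigA /= (reindex (fun U => (biidx1 U, biidx2 U))) //=.
exists (fun AB => (pair_idx AB.1.1 AB.2.1, pair_idx AB.1.2 AB.2.2)).
  by case=> I J _; rewrite /= !pair_idxK.
by case=> [[A1 A2] [B1 B2]] _; rewrite /biidx1 /biidx2 /= !idx1_pair !idx2_pair.
Qed.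

End ProductIndex.

(** * Elementary hypermatrices *)

Section Elementary.
Variables (K : comPzSemiRingType) (N p q : nat).

Definition elem_hmx (U : ('I_N ^ p) * ('I_N ^ q)) : hypermx K N p q :=
  [ffun V => (V == U)%:R : K].

Lemma hmx_sum_elem (A : hypermx K N p q) : A = \sum_U A U *: elem_hmx U.
Proof.
apply/ffunP=> V; rewrite sum_ffunE (bigD1 V) //= big1 => [|U neU].
  by rewrite !ffunE eqxx addr0 /GRing.scale /= mulr1.
by rewrite !ffunE eq_sym (negPf neU) /GRing.scale /= mulr0.
Qed.

End Elementary.

(** * The Kronecker product *)

Section Kronecker.
Variables (K : comPzSemiRingType) (M N : nat).

Local Notation X := (hypermx_modpro K M).
Local Notation Y := (hypermx_modpro K N).
Local Notation T := (tensor_modpro X Y).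
Local Notation Z := (hypermx_modpro K (M * N)).

Definition kron p q (A : hypermx K M p q) (B : hypermx K N p q) :
    hypermx K (M * N) p q :=
  [ffun U => (A (biidx1 U) : K) * B (biidx2 U)].

Lemma kron_bil p q : bilinear_op (@kron p q).
Proof.
split=> [a a' b|a b b'|k a b|k a b]; apply/ffunP=> U; rewrite !ffunE.
- by rewrite mulrDl.
- by rewrite mulrDr.
- by rewrite /GRing.scale /= mulrA.
- by rewrite /GRing.scale /= mulrCA.
Qed.

Lemma kron_hcomp m n m' n' (A : hypermx K M m n) (A' : hypermx K N m n)
    (B : hypermx K M m' n') (B' : hypermx K N m' n') :
  kron (hmx_hcomp A B) (hmx_hcomp A' B') = hmx_hcomp (kron A A') (kron B B').
Proof.
apply/ffunP=> U; rewrite !ffunE /biidx1 /biidx2 /=.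
by rewrite !idx1_lidx !idx1_ridx !idx2_lidx !idx2_ridx mulrACA.
Qed.

(** The product of the two sums over middle multi-indices distributes into one
    double sum, which [sum_idx] reads as a sum over multi-indices of [MN]. *)
Lemma kron_vcomp m n r (A : hypermx K M m n) (A' : hypermx K N m n)
    (B : hypermx K M n r) (B' : hypermx K N n r) :
  kron (hmx_vcomp A B) (hmx_vcomp A' B') = hmx_vcomp (kron A A') (kron B B').
Proof.
apply/ffunP=> U; rewrite !ffunE big_distrlr /= sum_idx.
by apply: eq_bigr => L _; rewrite !ffunE mulrACA.
Qed.

(** The bijection on multi-indices turns an equality test over [MN] into the
    conjunction of two tests, and a conjunction of tests is a product of 0-1
    entries; the same reason gives [kron_elem]. *)
Lemma kron_id n : kron (hmx_id K M n) (hmx_id K N n) = hmx_id K (M * N) n.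
Proof. by apply/ffunP=> U; rewrite !ffunE /= -natrM mulnb -eq_idx. Qed.

Lemma kron_elem p q (U : ('I_(M * N) ^ p) * ('I_(M * N) ^ q)) :
  kron (elem_hmx K (biidx1 U)) (elem_hmx K (biidx2 U)) = elem_hmx K U.
Proof. by apply/ffunP=> V; rewrite !ffunE -natrM mulnb -eq_biidx. Qed.

Definition tkron p q : T p q -> Z p q := tlift (@kron p q).

Lemma tkronE p q (A : hypermx K M p q) (B : hypermx K N p q) :
  tkron (tens A B) = kron A B.
Proof. exact: (tliftE (kron_bil p q)). Qed.

Lemma tkron_semilinear p q : semilinear (@tkron p q).
Proof.
split; first exact: (tliftZ (kron_bil p q)).
exact: (tliftD (kron_bil p q)).
Qed.

HB.instance Definition _ p q :=
  GRing.isSemilinear.Build K (T p q) (Z p q) *:%R (@tkron p q)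
    (tkron_semilinear p q).

Lemma tkron_morphism : pro_morphism (mp_pro T) (mp_pro Z) tkron.
Proof.
split=> [m n m' n'|m n r|n].
- apply: (tens_bil_ext (bil_comp_post (@tkron _ _) (tensor_hbil X Y _ _ _ _))
    (bil_comp_pre (@tkron _ _) (@tkron _ _) (hmx_hbil K _ _ _ _ _))).
  by move=> A A' B B'; rewrite tensor_hcompE /= !tkronE kron_hcomp.
- apply: (tens_bil_ext (bil_comp_post (@tkron _ _) (tensor_vbil X Y _ _ _))
    (bil_comp_pre (@tkron _ _) (@tkron _ _) (hmx_vbil K _ _ _ _))).
  by move=> A A' B B'; rewrite tensor_vcompE /= !tkronE kron_vcomp.
- exact: etrans (tkronE _ _) (kron_id n).
Qed.

Definition unkron p q (C : Z p q) : T p q :=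
  \sum_U (C U : K) *: tens (elem_hmx K (biidx1 U)) (elem_hmx K (biidx2 U)).

Lemma unkronK p q : cancel (@unkron p q) (@tkron p q).
Proof.
move=> C; rewrite linear_sum [RHS]hmx_sum_elem.
by apply: eq_bigr => U _; rewrite linearZ /= tkronE kron_elem.
Qed.

(** On a pure tensor, expanding both factors on elementary hypermatrices gives a
    double sum of scaled pure tensors, which [sum_biidx] turns into the single
    sum that defines [unkron]. *)
Lemma tkronK p q : cancel (@tkron p q) (@unkron p q).
Proof.
have tb := tens_bilinear (hypermx K M p q) (hypermx K N p q).
have unkronD C D : @unkron p q (C + D) = unkron C + unkron D.
  rewrite /unkron -big_split; apply: eq_bigr => U _.
  by rewrite ffunE scalerDl.
elim/tensor_car_ind => [|x y ex ey|A B].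
- by rewrite linear0 /unkron big1 // => U _; rewrite ffunE scale0r.
- by rewrite linearD unkronD ex ey.
rewrite tkronE [in RHS](hmx_sum_elem A) [in RHS](hmx_sum_elem B).
rewrite (bil_suml _ _ tb); under [RHS]eq_bigr do rewrite (bil_sumr _ _ tb).
rewrite sum_biidx; apply: eq_bigr => U _.
by rewrite ffunE (bilZl tb) (bilZr tb) scalerA.
Qed.

End Kronecker.

Theorem theorem1 (K : comPzSemiRingType) (M N : nat)
    (hM : (1 <= M)%N) (hN : (1 <= N)%N) :
  modpro_isomorphic
    (tensor_modpro (hypermx_modpro K M) (hypermx_modpro K N))
    (hypermx_modpro K (M * N)%N).
Proof.
exists (fun p q => @tkron K M N p q).
exact: (bij_pro_isomorphism (@tkron_morphism K M N) (@tkronK K M N)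
  (@unkronK K M N)).
Qed.
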